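(* In the setting described in the context, the subspace $\mathfrak s(G,H,\mu)\cdot m\subset T_mM$ is identified with a symplectic slice at $\mu$ for the $H$-action on the coadjoint orbit $G\cdot\mu$. That is, the subspace $\mathfrak s(G,H,\mu)\cdot\mu:=\{-\mathrm{ad}^*_x\mu: x\in\mathfrak s(G,H,\mu)\}\subset T_\mu(G\cdot\mu)$ is a symplectic slice at $\mu$ for the $H$-action on $G\cdot\mu$, and the map $x_M(m)\mapsto-\mathrm{ad}^*_x\mu$ ($x\in\mathfrak s(G,H,\mu)$) is a well-defined linear isomorphism $\mathfrak s(G,H,\mu)\cdot m\to\mathfrak s(G,H,\mu)\cdot\mu$.
   Context: Setting. $(M,\omega)$ is a symplectic manifold with a smooth proper action of a Lie group $G$ preserving $\omega$; for $x\in\mathfrak g$, $x_M$ denotes the vector field $x_M(p)=\frac{d}{dt}|_{t=0}\exp(tx)\cdot p$. There is a momentum map $\Phi_G:M\to\mathfrak g^*$, $\iota_{x_M}\omega=d\langle\Phi_G(\cdot),x\rangle$ for all $x\in\mathfrak g$, equivariant for the coadjoint action of $G$ on $\mathfrak g^*$ given by $\langle \mathrm{Ad}^*_{g^{-1}}\lambda,x\rangle=\langle\lambda,\mathrm{Ad}_{g^{-1}}x\rangle$. Write $\langle\mathrm{ad}^*_x\lambda,y\rangle=\langle\lambda,[x,y]\rangle$. $H\subset G$ is a Lie subgroup with Lie algebra $\mathfrak h$. Fix $m\in M$, $\mu=\Phi_G(m)$, $\alpha=\mu|_{\mathfrak h}\in\mathfrak h^*$. $G_m$ is the stabilizer of $m$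 (compact, since the action is proper); $\mathfrak g_\mu=\{x\in\mathfrak g:\mathrm{ad}^*_x\mu=0\}$, $\mathfrak h_\alpha=\{x\in\mathfrak h:\mathrm{ad}^*_x\alpha=0\text{ in }\mathfrak h^*\}$. For a subspace $\mathfrak k\subset\mathfrak g$, $\mathfrak k\cdot m=\{x_M(m):x\in\mathfrak k\}\subset T_mM$ and $\mathfrak k\cdot\mu=\{-\mathrm{ad}_x^*\mu:x\in\mathfrak k\}\subset T_\mu(G\cdot\mu)$. Standing assumption (A): $G_m$ acts on $H$ by conjugation, i.e. $kHk^{-1}=H$ for all $k\in G_m$. $\mathfrak h^{\perp_\mu}:=\{x\in\mathfrak g: x_M(m)\in(\mathfrak h\cdot m)^{\omega(m)}\}$, where $^{\omega(m)}$ denotes the symplectic orthogonal in $T_mM$; it contains $\mathfrak g_\mu+\mathfrak h_\alpha$. $\mathfrak s(G,H,\mu)$ is a chosen $G_m$-invariant complement to $\mathfrak g_\mu+\mathfrak h_\alpha$ in $\mathfrak h^{\perp_\mu}$. The coadjoint orbit $G\cdot\mu\subset\mathfrak g^*$ carries the Kostant–Kirillov–Souriau symplectic form, given at $\mu$ by $(-\mathrm{ad}^*_x\mu,-\mathrm{ad}^*_y\mu)\mapsto\langle\mu,[x,y]\rangle$. The momentum map of the $G$-action on $G\cdot\mu$ is the inclusion $G\cdot\mu\hookrightarrow\mathfrak g^*$, and that of the $H$-action is $\Phi:G\cdot\mu\to\mathfrak h^*$, $\Phi(\lambda)=\lambda|_{\mathfrak h}$, so $\Phi(\mu)=\alpha$.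 A symplectic slice at $\mu$ for the $H$-action on $G\cdot\mu$ means a complement to $\mathfrak h_\alpha\cdot\mu$ in $\ker(D\Phi(\mu))$ (a realization of the quotient $\ker(D\Phi(\mu))/\mathfrak h_\alpha\cdot\mu$). *)

(* Defs.v *)
From HB Require Import structures.
From mathcomp Require Import all_boot all_order all_algebra.
From mathcomp Require Import all_classical all_reals all_analysis.
Set Implicit Arguments.
Unset Strict Implicit.
Unset Printing Implicit Defensive.
Import Order.TTheory GRing.Theory Num.Theory.
Import numFieldNormedType.Exports.
Local Open Scope classical_set_scope.
Local Open Scope ring_scope.

Section LinearAlgebra.
Context {R : realType}.

Definition is_subspace (V : lmodType R) (A : set V) : Prop :=
  A 0 /\ forall (a : R) u v, A u -> A v -> A (a *: u + v).

Definition sumset (V : lmodType R) (A B : set V) : set V :=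
  [set a + b | a in A & b in B].

(* A is a linear complement of B in C, that is, C is the direct sum of A, B. *)
Definition complement_in (V : lmodType R) (A B C : set V) : Prop :=
  [/\ is_subspace A, A `&` B = [set 0] & sumset A B = C].

Definition linear_on (V W : lmodType R) (A : set V) (f : V -> W) : Prop :=
  forall (a : R) u v, A u -> A v -> f (a *: u + v) = a *: f u + f v.

Definition linear_iso_on (V W : lmodType R) (A : set V) (B : set W)
    (f : V -> W) : Prop :=
  [/\ is_subspace A, is_subspace B, linear_on A f & set_bij A B f].

End LinearAlgebra.

Section Manifolds.
Context {R : realType}.

(* C^k on an open set U of a finite-dimensional space V: all the directional
   derivatives of the (Frechet) differential are C^(k-1). *)
Fixpoint Ck (V W : normedModType R) (k : nat) (U : set V) (f : V -> W) : Prop :=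
  match k with
  | 0 => forall x, U x -> {for x, continuous f}
  | k'.+1 => (forall x, U x -> differentiable f x) /\
             forall v, Ck k' U (fun x => 'd f x v)
  end.

Definition smooth_on (V W : normedModType R) (U : set V) (f : V -> W) : Prop :=
  forall k, Ck k U f.

(* [chart_map] and [chart_inv] are total; only their values on [chart_dom] and
   on its image are meaningful. *)
Record chart (E : normedModType R) (X : topologicalType) := Chart {
  chart_dom : set X;
  chart_map : X -> E;
  chart_inv : E -> X
}.

Definition chart_img (E : normedModType R) (X : topologicalType)
  (c : chart E X) : set E := chart_map c @` chart_dom c.

Definition is_chart (E : normedModType R) (X : topologicalType)
    (c : chart E X) : Prop :=
  [/\ open (chart_dom c), open (chart_img c),
      forall p, chart_dom c p -> chart_inv c (chart_map c p) = p,
      forall p, chart_dom c p -> {for p, continuous (chart_map c)}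
    & forall x, chart_img c x -> {for x, continuous (chart_inv c)}].

(* A space with an atlas modelled on E and a preferred chart at every point.
   The tangent space at p is the model space E itself, read in the preferred
   chart at p. *)
Record charted (E : normedModType R) := Charted {
  charted_space :> topologicalType;
  atlas : set (chart E charted_space);
  chart_at : charted_space -> chart E charted_space
}.
Arguments atlas {E} X _ : rename.

Definition is_manifold (E : normedModType R) (X : charted E) : Prop :=
  [/\ hausdorff_space X, @second_countable X,
      forall c, atlas X c -> is_chart c,
      forall p : X, atlas X (chart_at p) /\ chart_dom (chart_at p) p
    & forall c d : chart E X, atlas X c -> atlas X d ->
        smooth_on (chart_map c @` (chart_dom c `&` chart_dom d))
                  (chart_map d \o chart_inv c)].

Definition model_chart (E : normedModType R) : chart E E :=
  Chart setT (@id E) (@id E).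

Definition model (E : normedModType R) : charted E :=
  @Charted E E [set model_chart E] (fun=> model_chart E).

Definition prod_chart (E F : normedModType R) (X Y : topologicalType)
    (c : chart E X) (d : chart F Y) : chart (E * F)%type (X * Y)%type :=
  Chart (chart_dom c `*` chart_dom d)
        (fun z : X * Y => (chart_map c z.1, chart_map d z.2))
        (fun w : E * F => (chart_inv c w.1, chart_inv d w.2)).

Definition prod_charted (E F : normedModType R) (X : charted E) (Y : charted F)
    : charted (E * F)%type :=
  @Charted (E * F)%type (X * Y)%type
    [set prod_chart c d | c in atlas X & d in atlas Y]
    (fun z => prod_chart (chart_at z.1) (chart_at z.2)).

Definition smooth (E F : normedModType R) (X : charted E) (Y : charted F)
    (f : X -> Y) : Prop :=
  continuous f /\
  forall (c : chart E X) (d : chart F Y), atlas X c -> atlas Y d ->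
    smooth_on (chart_map c @` (chart_dom c `&` f @^-1` chart_dom d))
              (chart_map d \o f \o chart_inv c).

Definition tmap (E F : normedModType R) (X : charted E) (Y : charted F)
    (f : X -> Y) (p : X) : E -> F :=
  'd (chart_map (chart_at (f p)) \o f \o chart_inv (chart_at p))
     (chart_map (chart_at p) p).

Definition smooth_curve (F : normedModType R) (Y : charted F) (c : R -> Y) :=
  smooth (X := model R) c.

Definition velocity (F : normedModType R) (Y : charted F) (c : R -> Y) : F :=
  tmap (X := model R) c 0 1.

Definition smooth_fun (E : normedModType R) (X : charted E) (f : X -> R) :=
  smooth (Y := model R) f.

Definition dfun (E : normedModType R) (X : charted E) (f : X -> R) (p : X)
  : E -> R := tmap (Y := model R) f p.

End Manifolds.
Arguments atlas {R E} X _ : rename.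

Section Symplectic.
Context {R : realType} {d : nat}.
Variable M : charted 'rV[R]_d.

(* om p : T_pM x T_pM -> R *)
Definition two_form := M -> 'rV[R]_d -> 'rV[R]_d -> R.

(* The component of om along the constant fields u, v in the chart c. *)
Definition chart_form (om : two_form) (c : chart 'rV[R]_d M)
    (u v x : 'rV[R]_d) : R :=
  om (chart_inv c x)
     (tmap (X := model 'rV[R]_d) (chart_inv c) x u)
     (tmap (X := model 'rV[R]_d) (chart_inv c) x v).

Record is_symplectic_form (om : two_form) : Prop := IsSymplecticForm {
  om_linear : forall p v (a : R) u1 u2,
    om p (a *: u1 + u2) v = a * om p u1 v + om p u2 v;
  om_antisym : forall p u v, om p u v = - om p v u;
  om_nondegenerate : forall p u, (forall v, om p u v = 0) -> u = 0;
  om_smooth : forall c : chart 'rV[R]_d M, atlas M c ->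
    forall u v, smooth_on (chart_img c) (chart_form om c u v);
  om_closed : forall c : chart 'rV[R]_d M, atlas M c ->
    forall x, chart_img c x -> forall u v w,
      'd (chart_form om c v w) x u - 'd (chart_form om c u w) x v
      + 'd (chart_form om c u v) x w = 0 :> R
}.

Definition symp_orth (om : two_form) (p : M) (A : set 'rV[R]_d)
    : set 'rV[R]_d :=
  [set v | forall w, A w -> om p v w = 0].

End Symplectic.

Section LieGroups.
Context {R : realType}.

Record lie_group (n : nat) := LieGroup {
  lg_space :> charted 'rV[R]_n;
  lg_mul : lg_space -> lg_space -> lg_space;
  lg_inv : lg_space -> lg_space;
  lg_one : lg_space;
  lg_manifold : is_manifold lg_space;
  lg_mulA : associative lg_mul;
  lg_mul1 : left_id lg_one lg_mul;
  lg_mulV : left_inverse lg_one lg_inv lg_mul;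
  lg_mul_smooth :
    smooth (X := prod_charted lg_space lg_space)
           (fun z => lg_mul z.1 z.2);
  lg_inv_smooth : smooth lg_inv
}.

(* The Lie algebra of G is T_1 G = 'rV[R]_n (read in the preferred chart at 1)
   and the bracket is [x, y] = ad x y with ad the tangent map of Ad at 1. *)
Definition Ad (n : nat) (G : lie_group n) (g : G) : 'rV[R]_n -> 'rV[R]_n :=
  tmap (fun h : G => lg_mul (lg_mul g h) (lg_inv g)) (lg_one G).

Definition bracket (n : nat) (G : lie_group n) (x y : 'rV[R]_n) : 'rV[R]_n :=
  tmap (Y := model 'rV[R]_n) (fun g : G => Ad g y) (lg_one G) x.

(* Every Lie group has exactly one map with this property, its exponential:
   t |-> exp (t x) is the one-parameter subgroup with initial velocity x. *)
Definition is_exponential (n : nat) (G : lie_group n) (exp : 'rV[R]_n -> G)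
    : Prop :=
  forall x : 'rV[R]_n,
    [/\ forall s t : R,
          exp ((s + t) *: x) = lg_mul (exp (s *: x)) (exp (t *: x)),
        smooth_curve (fun t : R => exp (t *: x))
      & velocity (fun t : R => exp (t *: x)) = x].

(* A (possibly only immersed) Lie subgroup of G, presented as an injective
   immersive homomorphism i : H -> G. *)
Record is_lie_subgroup (k n : nat) (H : lie_group k) (G : lie_group n)
    (i : H -> G) : Prop := IsLieSubgroup {
  ls_smooth : smooth i;
  ls_mul : forall g h, i (lg_mul g h) = lg_mul (i g) (i h);
  ls_inj : injective i;
  ls_immersion : forall h, injective (tmap i h)
}.

Definition lie_subalg (k n : nat) (H : lie_group k) (G : lie_group n)
  (i : H -> G) : set 'rV[R]_n := range (tmap i (lg_one H)).

End LieGroups.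

(* The dual of the Lie algebra 'rV_n consists of the linear maps in the function
   space 'rV_n -> R^o; the dual of a subspace h consists of the restrictions to
   h of such maps, extended by 0 outside h. *)
Section Coadjoint.
Context {R : realType} {n : nat}.
Variable G : @lie_group R n.
Implicit Types (g : G) (x y : 'rV[R]_n) (l mu : 'rV[R]_n -> R^o)
  (h : set 'rV[R]_n).

(* Ad^*_{g^-1} l *)
Definition coad g l : 'rV[R]_n -> R^o := fun y => l (Ad (lg_inv g) y).

(* ad^*_x l *)
Definition adstar x l : 'rV[R]_n -> R^o := fun y => l (bracket G x y).

Definition restr h l : 'rV[R]_n -> R^o := patch (cst 0) h l.

Definition stab_alg mu : set 'rV[R]_n := [set x | adstar x mu = 0].

Definition sub_stab_alg h mu : set 'rV[R]_n :=
  [set x | h x /\ restr h (adstar x (restr h mu)) = 0].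

(* k . mu, a subset of T_mu (G . mu) for k a subspace of the Lie algebra *)
Definition dot_dual (k : set 'rV[R]_n) mu : set ('rV[R]_n -> R^o) :=
  [set - adstar x mu | x in k].

Definition dual_velocity (c : R -> 'rV[R]_n -> R^o) : 'rV[R]_n -> R^o :=
  fun y => derive1 (fun t : R => c t y : R) 0.

(* The kernel of the differential at mu of the map l |-> l|_h on the coadjoint
   orbit of mu. As G -> G . mu, g |-> coad g mu, is a submersion, the tangent
   vectors of the orbit at mu are the velocities at 0 of the curves
   t |-> coad (c t) mu with c a smooth curve of G such that c 0 = 1. *)
Definition ker_dPhi h mu : set ('rV[R]_n -> R^o) :=
  [set xi | exists c : R -> G,
    [/\ smooth_curve c, c 0 = lg_one G,
        xi = dual_velocity (fun t => coad (c t) mu)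
      & dual_velocity (fun t => restr h (coad (c t) mu)) = 0]].

Definition is_symplectic_slice (S : set ('rV[R]_n -> R^o)) h mu : Prop :=
  complement_in S (dot_dual (sub_stab_alg h mu) mu) (ker_dPhi h mu).

End Coadjoint.

Section HamiltonianAction.
Context {R : realType} {n d : nat}.
Variables (G : @lie_group R n) (M : charted 'rV[R]_d).
Variables (exp : 'rV[R]_n -> G) (act : G -> M -> M) (om : two_form M).

Record is_proper_action : Prop := IsProperAction {
  act_one : forall p, act (lg_one G) p = p;
  act_mul : forall g h p, act (lg_mul g h) p = act g (act h p);
  act_smooth : smooth (X := prod_charted G M) (fun z => act z.1 z.2);
  act_proper : forall K : set (M * M), compact K ->
    compact ((fun z : G * M => (act z.1 z.2, z.2)) @^-1` K)
}.

Definition preserves_form : Prop := forall g p u v,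
  om (act g p) (tmap (act g) p u) (tmap (act g) p v) = om p u v.

(* the vector field x_M *)
Definition fund (x : 'rV[R]_n) (p : M) : 'rV[R]_d :=
  velocity (fun t : R => act (exp (t *: x)) p).

Record is_momentum_map (Phi : M -> 'rV[R]_n -> R^o) : Prop := IsMomentumMap {
  mom_linear : forall p, linear (Phi p);
  mom_smooth : forall x, smooth_fun (fun p => Phi p x);
  mom_eq : forall x p v, om p (fund x p) v = dfun (fun q => Phi q x) p v;
  mom_equivariant : forall g p, Phi (act g p) = coad g (Phi p)
}.

Definition stabilizer (p : M) : set G := [set g | act g p = p].

(* k . p, a subset of T_p M for k a subspace of the Lie algebra *)
Definition dot_pt (k : set 'rV[R]_n) (p : M) : set 'rV[R]_d :=
  [set fund x p | x in k].

Definition perp (h : set 'rV[R]_n) (p : M) : set 'rV[R]_n :=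
  [set x | symp_orth om p (dot_pt h p) (fund x p)].

End HamiltonianAction.

(* Main.v *)
(* Write mu = Phi m and h = Lie(H). Equivariance of Phi and the momentum map
   equation give om(x_M(m), y_M(m)) = <mu, [x, y]>, so that
   h^{perp_mu} = {x | <mu, [x, y]> = 0 for all y in h}. Differentiating
   t |-> Ad^*_{c(t)^-1} mu along curves c through 1 shows that the kernel of
   D Phi(mu) on the coadjoint orbit is h^{perp_mu} . mu. The linear map
   x |-> - ad^*_x mu has kernel g_mu, hence it sends the decomposition
   h^{perp_mu} = s + (g_mu + h_alpha) to ker D Phi(mu) = s.mu + h_alpha.mu, a
   direct sum, and it is injective on s. The isomorphism s.m -> s.mu is the
   restriction of v |-> - om(v, (.)_M(m)), which is linear on all of T_m M and
   sends x_M(m) to - ad^*_x mu. *)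

Require Import Defs.
From HB Require Import structures.
From mathcomp Require Import all_boot all_order all_algebra.
From mathcomp Require Import all_classical all_reals all_analysis.
Set Implicit Arguments.
Unset Strict Implicit.
Unset Printing Implicit Defensive.
Import Order.TTheory GRing.Theory Num.Theory.
Import numFieldNormedType.Exports.
Local Open Scope classical_set_scope.
Local Open Scope ring_scope.

(** * Differential calculus on row vectors *)

Lemma linear_rowE (R : realType) (n : nat) (W : lmodType R)
    (l : 'rV[R]_n -> W) :
  linear l -> forall v, l v = \sum_(j < n) v 0 j *: l (delta_mx 0 j).
Proof.
move=> ll v; pose L : {linear 'rV[R]_n -> W} :=
  HB.pack l (GRing.isLinear.Build _ _ _ _ _ ll).
rewrite -[l]/(L : _ -> _) {1}[v]row_sum_delta linear_sum.
by apply: eq_bigr => j _; rewrite linearZ.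
Qed.

Lemma differentiable_sum_scale (R : realType) (V W : normedModType R) (n : nat)
    (f : 'I_n -> V -> R) (w : 'I_n -> W) (x : V) :
  (forall j, differentiable (f j) x) ->
  differentiable (fun a => \sum_(j < n) f j a *: w j) x.
Proof.
move=> df; rewrite (_ : (fun _ => _) = \sum_(j < n) (fun a => f j a *: w j)).
  by apply: differentiable_sum => j; exact: differentiableZl.
by apply/funext => a; rewrite fct_sumE.
Qed.

Lemma differentiable_row (R : realType) (V : normedModType R) (n : nat)
    (f : V -> 'rV[R]_n) (x : V) :
  (forall j, differentiable (fun a => f a 0 j : R) x) -> differentiable f x.
Proof.
move=> df; rewrite (_ : f = fun a => \sum_(j < n) f a 0 j *: delta_mx 0 j).
  exact: (differentiable_sum_scale (fun j => delta_mx 0 j) df).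
by apply/funext => a; exact: row_sum_delta.
Qed.

(** [diff_lin] asks for continuity. In finite dimension it comes from the expansion of [l] in
    coordinates, each of which is differentiable. *)
Lemma differentiable_linear_row (R : realType) (n : nat) (W : normedModType R)
    (l : 'rV[R]_n -> W) (x : 'rV[R]_n) :
  linear l -> differentiable l x /\ 'd l x = l :> (_ -> _).
Proof.
move=> ll.
have dl v : differentiable l v.
  rewrite (_ : l = fun v => \sum_(j < n) v 0 j *: l (delta_mx 0 j)).
    apply: (differentiable_sum_scale (fun j => l (delta_mx 0 j))) => j.
    exact: differentiable_coord.
  by apply/funext; exact: linear_rowE.
split=> //; pose L : {linear 'rV[R]_n -> W} :=
  HB.pack l (GRing.isLinear.Build _ _ _ _ _ ll).
apply: (@diff_lin _ _ _ L) => v; exact: differentiable_continuous.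
Qed.

Lemma differentiable_scale_row (R : realType) (V : normedModType R) (n : nat)
    (f : V -> R) (g : V -> 'rV[R]_n) (x : V) :
  differentiable f x -> differentiable g x ->
  differentiable (fun a => f a *: g a) x.
Proof.
move=> df dg; apply: differentiable_row => j.
rewrite (_ : (fun _ => _) = f * (fun a => g a 0 j)); last first.
  by apply/funext => a; rewrite mxE.
apply: differentiableM => //.
exact: (differentiable_comp dg (differentiable_coord _ 0 j)).
Qed.

Lemma diff_scaleD (R : realType) (V W : normedModType R) (f g h : V -> W)
    (a : R) (x v : V) :
  h = a *: f + g -> differentiable f x -> differentiable g x ->
  'd h x v = a *: 'd f x v + 'd g x v.
Proof.
move=> -> df dg.
apply: etrans (congr1 (@^~ v) (diffD (differentiableZ a df) dg)) _.
exact: (congr1 (fun F => F v + 'd g x v) (diffZ a df)).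
Qed.

(** The first-order expansion at [x] depends only on the germ there: ['d f x] also expands [g], and
    uniqueness of the differential identifies it with ['d g x]. This is what allows chart formulas
    that are valid only locally. *)
Lemma near_eq_diff (R : realType) (V W : normedModType R) (f g : V -> W)
    (x : V) :
  {near x, f =1 g} -> differentiable f x ->
  differentiable g x /\ 'd g x = 'd f x :> (V -> W).
Proof.
move=> fg df.
have dg : g \o shift x = cst (g x) + 'd f x +o_ 0 id.
  have /eqaddoP H := diff_locally df.
  apply/eqaddoP => e e0; move: (H e e0); apply: filter_app.
  have : \forall t \near (0 : V), f (t + x) = g (t + x).
    by move: fg; rewrite (near_shift 0) /= subr0.
  (* The constant terms agree because a neighbourhood of [x] contains [x] itself. *)
  rewrite -(nbhs_singleton fg); apply: filter_app; near=> t.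
  by move=> ft; rewrite /= !fctE /= ft.
have E := diff_unique (diff_continuous df) dg.
split=> //; apply/diff_locallyP; split; last by rewrite E.
by rewrite E; exact: diff_continuous.
Unshelve. all: by end_near. Qed.

(** * Tangent maps *)

Section TangentMaps.
Context {R : realType}.

(** The part of [is_manifold] that concerns the preferred charts. It passes directly to products and
    to model spaces, so the calculus of tangent maps is built on it. *)
Definition good_charts (E : normedModType R) (X : charted E) : Prop :=
  forall p : X, [/\ atlas X (chart_at p), is_chart (chart_at p)
                  & chart_dom (chart_at p) p].

Definition chart_rep (E F : normedModType R) (X : charted E) (Y : charted F)
    (f : X -> Y) (p : X) : E -> F :=
  chart_map (chart_at (f p)) \o f \o chart_inv (chart_at p).

(** Continuity is a separate clause: chart maps are total with arbitrary values off their domains,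
    so a differentiable representative does not force [f] to be continuous. *)
Definition differentiable_at (E F : normedModType R) (X : charted E)
    (Y : charted F) (f : X -> Y) (p : X) : Prop :=
  {for p, continuous f} /\
  differentiable (chart_rep f p) (chart_map (chart_at p) p).

Lemma good_charts_manifold (E : normedModType R) (X : charted E) :
  is_manifold X -> good_charts X.
Proof.
by case=> _ _ hc ha _ p; have [h1 h2] := ha p; split=> //; exact: hc.
Qed.

Lemma good_charts_model (E : normedModType R) : good_charts (model E).
Proof.
move=> p; split=> //; split=> //=.
- exact: openT.
- by rewrite /chart_img /= image_id; exact: openT.
- by move=> x _; exact: cvg_id.
- by move=> x _; exact: cvg_id.
Qed.

Lemma chart_imgX (E F : normedModType R) (X Y : topologicalType)
    (c : chart E X) (d : chart F Y) :
  chart_img (prod_chart c d) = chart_img c `*` chart_img d.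
Proof.
apply/seteqP; split=> [_ [[p q] [/= hp hq] <-]|[x y] [/= [p hp <-] [q hq <-]]].
  by split; [exists p|exists q].
by exists (p, q).
Qed.

Lemma openX (X Y : topologicalType) (A : set X) (B : set Y) :
  open A -> open B -> open (A `*` B).
Proof.
rewrite !openE => oA oB [x y] [/= /oA Ax /oB By].
by exists (A, B).
Qed.

Lemma is_chart_prod (E F : normedModType R) (X Y : topologicalType)
    (c : chart E X) (d : chart F Y) :
  is_chart c -> is_chart d -> is_chart (prod_chart c d).
Proof.
case=> c1 c2 c3 c4 c5 [d1 d2 d3 d4 d5]; split.
- exact: openX.
- by rewrite chart_imgX; exact: openX.
- by move=> [p q] [/= hp hq]; rewrite c3 // d3.
- move=> [p q] [/= hp hq].
  apply: (@cvg_pair _ _ _ _ (nbhs _) (nbhs _)).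
    apply: (cvg_comp (fun z : X * Y => z.1) (chart_map c));
      [exact: cvg_fst|exact: c4].
  apply: (cvg_comp (fun z : X * Y => z.2) (chart_map d));
    [exact: cvg_snd|exact: d4].
- rewrite chart_imgX => -[p q] [/= hp hq].
  apply: (@cvg_pair _ _ _ _ (nbhs _) (nbhs _)).
    apply: (cvg_comp (fun z : E * F => z.1) (chart_inv c));
      [exact: cvg_fst|exact: c5].
  apply: (cvg_comp (fun z : E * F => z.2) (chart_inv d));
    [exact: cvg_snd|exact: d5].
Qed.

Lemma good_charts_prod (E F : normedModType R) (X : charted E)
    (Y : charted F) :
  good_charts X -> good_charts Y -> good_charts (prod_charted X Y).
Proof.
move=> gX gY [p q]; have [p1 p2 p3] := gX p; have [q1 q2 q3] := gY q.
split=> //; last exact: is_chart_prod.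
by exists (chart_at p) => //; exists (chart_at q).
Qed.

Lemma chart_atK (E : normedModType R) (X : charted E) (p : X) :
  good_charts X -> chart_inv (chart_at p) (chart_map (chart_at p) p) = p.
Proof. by move=> /(_ p) [_ [_ _ h _ _] hp]; exact: h. Qed.

Lemma chart_inv_cvg (E : normedModType R) (X : charted E) (p : X) :
  good_charts X ->
  chart_inv (chart_at p) x @[x --> chart_map (chart_at p) p] --> p.
Proof.
move=> gX; have [_ [_ _ h _ c] hp] := gX p.
rewrite -[X in _ --> X](chart_atK p gX); apply: c; exists p => //.
Qed.

Lemma smooth_differentiable_at (E F : normedModType R) (X : charted E)
    (Y : charted F) (f : X -> Y) (p : X) :
  good_charts X -> good_charts Y -> smooth f -> differentiable_at f p.
Proof.
move=> gX gY [fc fs]; split; first exact: fc.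
have [aX _ hp] := gX p; have [aY _ hq] := gY (f p).
have [+ _] := fs _ _ aX aY 1%N; apply.
by exists p.
Qed.

(** The two middle charts cancel only on the domain of the chart at [f p]; continuity of [f] keeps
    nearby points inside it. *)
Lemma chart_rep_comp (E F K : normedModType R) (X : charted E)
    (Y : charted F) (Z : charted K) (f : X -> Y) (g : Y -> Z) (p : X) :
  good_charts X -> good_charts Y -> {for p, continuous f} ->
  \forall x \near chart_map (chart_at p) p,
    (chart_rep g (f p) \o chart_rep f p) x = chart_rep (g \o f) p x.
Proof.
move=> gX gY fc; have [_ [oq _ hq _ _] fpq] := gY (f p).
have H : \forall x \near chart_map (chart_at p) p,
    chart_dom (chart_at (f p)) (f (chart_inv (chart_at p) x)).
  have hn : nbhs (f p) (chart_dom (chart_at (f p))) by exact: open_nbhs_nbhs.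
  exact: (chart_inv_cvg (p := p) gX (fc _ hn)).
by apply: filterS H => x hx; rewrite /chart_rep /= hq.
Qed.

Lemma chart_rep_at (E F : normedModType R) (X : charted E) (Y : charted F)
    (f : X -> Y) (p : X) : good_charts X ->
  chart_rep f p (chart_map (chart_at p) p) = chart_map (chart_at (f p)) (f p).
Proof. by move=> gX; rewrite /chart_rep /= chart_atK. Qed.

Lemma differentiable_at_tmap_comp (E F K : normedModType R) (X : charted E)
    (Y : charted F) (Z : charted K) (f : X -> Y) (g : Y -> Z) (p : X) :
  good_charts X -> good_charts Y ->
  differentiable_at f p -> differentiable_at g (f p) ->
  differentiable_at (g \o f) p /\ tmap (g \o f) p = tmap g (f p) \o tmap f p.
Proof.
move=> gX gY [fc df] [gc dg].
(* The base point is rewritten as the value of the representative of [f], the form in which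
   [differentiable_comp] composes the two. *)
move: dg; rewrite /differentiable_at -(chart_rep_at f p gX) => dg.
have [h1 h2] := near_eq_diff (chart_rep_comp g gX gY fc)
  (differentiable_comp df dg).
split; first by split=> //; apply: continuous_comp.
by rewrite /tmap h2 diff_comp // -chart_rep_at.
Qed.

Lemma differentiable_at_comp (E F K : normedModType R) (X : charted E)
    (Y : charted F) (Z : charted K) (f : X -> Y) (g : Y -> Z) (p : X) :
  good_charts X -> good_charts Y ->
  differentiable_at f p -> differentiable_at g (f p) ->
  differentiable_at (g \o f) p.
Proof.
by move=> gX gY df dg; case: (differentiable_at_tmap_comp gX gY df dg).
Qed.

Lemma tmap_comp (E F K : normedModType R) (X : charted E)
    (Y : charted F) (Z : charted K) (f : X -> Y) (g : Y -> Z) (p : X) :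
  good_charts X -> good_charts Y ->
  differentiable_at f p -> differentiable_at g (f p) ->
  tmap (g \o f) p = tmap g (f p) \o tmap f p.
Proof.
by move=> gX gY df dg; case: (differentiable_at_tmap_comp gX gY df dg).
Qed.

Lemma is_diff_at (V W : normedModType R) (f : V -> W) x df :
  is_diff x f df -> differentiable f x /\ 'd f x = df :> (V -> W).
Proof. by case. Qed.

Lemma differentiable_at_tmap_cst (E F : normedModType R) (X : charted E)
    (Y : charted F) (q : Y) (p : X) :
  differentiable_at (fun _ : X => q) p /\ tmap (fun _ : X => q) p = 0.
Proof.
split; last exact: diff_cst.
split; [exact: cvg_cst|exact: differentiable_cst].
Qed.

(** The representative is the identity only on the image of the chart, which is an open
    neighbourhood of the base point. *)
Lemma differentiable_at_tmap_id (E : normedModType R) (X : charted E) (p : X) :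
  good_charts X -> differentiable_at (@id X) p /\ tmap (@id X) p = id.
Proof.
move=> gX; have [_ [od oi hK hc hic] hp] := gX p.
have H : {near chart_map (chart_at p) p, @id E =1 chart_rep (@id X) p}.
  have : chart_img (chart_at p) (chart_map (chart_at p) p) by exists p.
  move: oi; rewrite openE => /[apply]; apply: filterS => _ [q hq <-].
  by rewrite /chart_rep /= hK.
have [d1 d2] := is_diff_at (is_diff_id (chart_map (chart_at p) p)).
have [h1 h2] := near_eq_diff H d1.
by split; [split|rewrite /tmap h2 d2].
Qed.

(** The preferred charts of [prod_charted] are products of preferred charts, so the representative
    of the pair is literally the pair of representatives. *)
Lemma differentiable_at_tmap_pair (E F K : normedModType R) (X : charted E)
    (Y : charted F) (Z : charted K) (f : X -> Y) (g : X -> Z) (p : X) :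
  differentiable_at f p -> differentiable_at g p ->
  differentiable_at (Y := prod_charted Y Z) (fun x => (f x, g x)) p /\
  tmap (Y := prod_charted Y Z) (fun x => (f x, g x)) p
    = fun v => (tmap f p v, tmap g p v).
Proof.
move=> [fc df] [gc dg]; split; last exact: diff_pair.
by split; [exact: cvg_pair|exact: differentiable_pair].
Qed.

Lemma tmap_linear (E F : normedModType R) (X : charted E) (Y : charted F)
    (f : X -> Y) (p : X) : linear (tmap f p).
Proof. by move=> a u v; rewrite /tmap linearP. Qed.

Lemma tmap_model (E F : normedModType R) (f : E -> F) (x : E) :
  tmap (X := model E) (Y := model F) f x = 'd f x :> (E -> F).
Proof. by []. Qed.

End TangentMaps.

(** * The adjoint representation *)

Section LieGroupTheory.
Context {R : realType} {n : nat}.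
Variable G : @lie_group R n.
Local Notation "1g" := (lg_one G).
Local Notation mulG := (fun z : prod_charted G G => lg_mul z.1 z.2).

Lemma good_charts_lie_group : good_charts G.
Proof. exact: good_charts_manifold (lg_manifold G). Qed.
Let gG := good_charts_lie_group.

Lemma lg_mulV_r (g : G) : lg_mul g (lg_inv g) = 1g.
Proof.
rewrite -[LHS]lg_mul1 -{1}(lg_mulV (lg_inv g)) -lg_mulA.
by rewrite [X in lg_mul _ X]lg_mulA lg_mulV lg_mul1 lg_mulV.
Qed.

Lemma lg_mul1_r (g : G) : lg_mul g 1g = g.
Proof. by rewrite -(lg_mulV g) lg_mulA lg_mulV_r lg_mul1. Qed.

Lemma lg_inv1 : lg_inv 1g = 1g.
Proof. by rewrite -[LHS]lg_mul1_r lg_mulV. Qed.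

Lemma lg_conj1 (g : G) : lg_mul (lg_mul g 1g) (lg_inv g) = 1g.
Proof. by rewrite lg_mul1_r lg_mulV_r. Qed.

Lemma lg_idem (g : G) : lg_mul g g = g -> g = 1g.
Proof. by move=> gg; rewrite -[LHS]lg_mul1 -(lg_mulV g) -lg_mulA gg. Qed.

Lemma differentiable_at_lg_mul (z : G * G) : differentiable_at mulG z.
Proof.
apply: smooth_differentiable_at; last exact: lg_mul_smooth; last exact: gG.
exact: good_charts_prod.
Qed.

Lemma differentiable_at_lg_inv (g : G) : differentiable_at (@lg_inv _ _ G) g.
Proof. by apply: smooth_differentiable_at => //; exact: lg_inv_smooth. Qed.

Lemma differentiable_at_mul (E : normedModType R) (X : charted E)
    (f g : X -> G) (p : X) : good_charts X ->
  differentiable_at f p -> differentiable_at g p ->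
  differentiable_at (fun x => lg_mul (f x) (g x)) p.
Proof.
move=> gX df dg; have [dfg _] := differentiable_at_tmap_pair df dg.
by have := differentiable_at_comp gX (good_charts_prod gG gG) dfg
  (differentiable_at_lg_mul _).
Qed.

(** By linearity it suffices to treat [(u, 0)] and [(0, v)]. Along each factor multiplication by [1]
    is the identity map, whose tangent map is known. *)
Lemma tmap_mul1 (u v : 'rV[R]_n) : tmap mulG (1g, 1g) (u, v) = u + v.
Proof.
have [i1 i2] := differentiable_at_tmap_id 1g gG.
have [c1 c2] := differentiable_at_tmap_cst (X := G) 1g 1g.
have gGG := good_charts_prod gG gG.
have hl : tmap mulG (1g, 1g) (u, 0) = u.
  have [p1 p2] := differentiable_at_tmap_pair i1 c1.
  have := tmap_comp gG gGG p1 (differentiable_at_lg_mul _).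
  rewrite (_ : _ \o _ = id); last by apply/funext => x /=; rewrite lg_mul1_r.
  by rewrite i2 => /(congr1 (@^~ u)); rewrite /= p2 i2 c2.
have hr : tmap mulG (1g, 1g) (0, v) = v.
  have [p1 p2] := differentiable_at_tmap_pair c1 i1.
  have := tmap_comp gG gGG p1 (differentiable_at_lg_mul _).
  rewrite (_ : _ \o _ = id); last by apply/funext => x /=; rewrite lg_mul1.
  by rewrite i2 => /(congr1 (@^~ v)); rewrite /= p2 i2 c2.
rewrite -[in RHS]hl -[in RHS]hr /tmap -linearD; congr ('d _ _ _).
by apply/pair_equal_spec; rewrite /= addr0 add0r.
Qed.

(** Differentiating the constant product of [c x] and its inverse at [p] gives a sum equal to 0, by
    [tmap_mul1]. *)
Lemma tmap_inv_curve (E : normedModType R) (X : charted E) (c : X -> G)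
    (p : X) :
  good_charts X -> differentiable_at c p -> c p = 1g ->
  differentiable_at (fun x => lg_inv (c x)) p /\
  forall v, tmap (fun x => lg_inv (c x)) p v = - tmap c p v.
Proof.
move=> gX dc cp.
have di : differentiable_at (fun x => lg_inv (c x)) p.
  exact: (differentiable_at_comp gX gG dc (differentiable_at_lg_inv _)).
split=> // v; have [p1 p2] := differentiable_at_tmap_pair dc di.
have := tmap_comp gX (good_charts_prod gG gG) p1 (differentiable_at_lg_mul _).
rewrite (_ : _ \o _ = fun=> 1g); last first.
  by apply/funext => x /=; rewrite lg_mulV_r.
have [_ ->] := differentiable_at_tmap_cst (Y := G) 1g p.
move=> /(congr1 (@^~ v)); rewrite /= p2 cp lg_inv1 tmap_mul1 => /esym/eqP.
by rewrite addrC addr_eq0 => /eqP.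
Qed.

Lemma differentiable_at_conj (g h : G) :
  differentiable_at (fun h => lg_mul (lg_mul g h) (lg_inv g)) h.
Proof.
have dcst q : differentiable_at (fun _ : G => q) h.
  by have [] := differentiable_at_tmap_cst (X := G) q h.
apply: differentiable_at_mul => //; apply: differentiable_at_mul => //.
by have [] := differentiable_at_tmap_id h gG.
Qed.

Local Notation phi := (chart_map (chart_at 1g)).
Local Notation psi := (chart_inv (chart_at 1g)).
Local Notation dom1 := (chart_dom (chart_at 1g)).
Local Notation a0 := (phi 1g).
Local Notation m1 := (chart_map (chart_at 1g) \o mulG
  \o chart_inv (prod_chart (chart_at 1g) (chart_at 1g))).

(* [Ad g y] must be read in the chart at [1] although [g] moves: in that chart
   conjugation by [g] is [b |-> m1 (m1 (g, b), g^-1)], with [m1] the product. *)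
Lemma Ad_rep (g : G) (y : 'rV[R]_n) :
  dom1 g -> dom1 (lg_inv g) ->
  Ad g y = 'd m1 (phi g, phi (lg_inv g)) ('d m1 (phi g, a0) (0, y), 0).
Proof.
move=> hg hgi.
have [aG [od oi hK hc hic] h1] := gG 1g.
have dm h : dom1 h -> dom1 (lg_mul g h) ->
    differentiable m1 (phi g, phi h).
  move=> hh hgh; have [_ sm] := lg_mul_smooth G.
  have hp : atlas (prod_charted G G) (prod_chart (chart_at 1g) (chart_at 1g)).
    by exists (chart_at 1g) => //; exists (chart_at 1g).
  have [+ _] := sm _ _ hp aG 1%N; apply.
  by exists (g, h).
have d1 : differentiable m1 (phi g, a0) by apply: dm => //; rewrite lg_mul1_r.
have d2 : differentiable m1 (phi g, phi (lg_inv g)).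
  by apply: dm => //; rewrite lg_mulV_r.
(* At the identity the inner product is [g] itself, so the outer differential is based at
   [(phi g, phi (lg_inv g))]. *)
have m1a : m1 (phi g, a0) = phi g by rewrite /= !hK // lg_mul1_r.
have e1 := differentiableP (differentiable_cst (phi g) a0).
pose l (b : 'rV[R]_n) := m1 (phi g, b).
have idl : is_diff a0 l (fun v => 'd m1 (phi g, a0) (0, v)).
  apply: (@is_diff_comp _ _ _ _ (fun b => (phi g, b)) (fun v => (0, v))).
  exact: DiffDef.
have idF : is_diff a0 (fun b => m1 (l b, phi (lg_inv g)))
    (fun v => 'd m1 (phi g, phi (lg_inv g)) ('d m1 (phi g, a0) (0, v), 0)).
  apply: (@is_diff_comp _ _ _ _ (fun b => (l b, phi (lg_inv g)))
    (fun v => ('d m1 (phi g, a0) (0, v), 0))).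
  by rewrite /l m1a; exact: DiffDef.
have [d3 d4] := is_diff_at idF.
have F : {near a0, (fun b => m1 (l b, phi (lg_inv g))) =1
    chart_rep (fun h : G => lg_mul (lg_mul g h) (lg_inv g)) 1g}.
  have H : \forall b \near a0, dom1 (lg_mul g (psi b)).
    have [mc _] := differentiable_at_mul gG
      (proj1 (differentiable_at_tmap_cst (X := G) g 1g))
      (proj1 (differentiable_at_tmap_id 1g gG)).
    have hn : nbhs (lg_mul g 1g) dom1.
      by apply: open_nbhs_nbhs; split; rewrite // lg_mul1_r.
    exact: (chart_inv_cvg (p := 1g) gG (mc _ hn)).
  apply: filterS H => b hb; rewrite /chart_rep /= lg_conj1.
  by rewrite /l /= (hK g hg) (hK _ hb) (hK _ hgi).
have [_ E] := near_eq_diff F d3.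
exact: (congr1 (@^~ y) (etrans E d4)).
Qed.

(* The right-hand side of [Ad_rep] is differentiable in [g] because [m1] is C^2;
   expanding the inner vector in a basis leaves differentials of [m1] evaluated
   at fixed vectors, as in the definition of [Ck]. *)
Lemma differentiable_Ad_rep (y : 'rV[R]_n) :
  differentiable (fun a => 'd m1 (a, chart_rep (@lg_inv _ _ G) 1g a)
                              ('d m1 (a, a0) (0, y), 0)) a0.
Proof.
have [aG _ h1] := gG 1g.
have dm v : differentiable (fun z => 'd m1 z v) (a0, a0).
  have hp : atlas (prod_charted G G) (prod_chart (chart_at 1g) (chart_at 1g)).
    by exists (chart_at 1g) => //; exists (chart_at 1g).
  have [_ sm] := lg_mul_smooth G.
  have [_ /(_ v) [+ _]] := sm _ _ hp aG 2%N; apply.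
  by exists (1g, 1g) => //; split; [split|rewrite /= lg_mul1].
have [_ di] := differentiable_at_lg_inv 1g.
have ia : chart_rep (@lg_inv _ _ G) 1g a0 = a0.
  by rewrite chart_rep_at // lg_inv1.
rewrite (_ : (fun _ => _) = fun a => \sum_(j < n) ('d m1 (a, a0) (0, y)) 0 j *:
    'd m1 (a, chart_rep (@lg_inv _ _ G) 1g a) (delta_mx 0 j, 0)); last first.
  apply/funext => a; apply: (linear_rowE (l := fun w => 'd m1 _ (w, 0))).
  move=> c u v; rewrite -linearP; congr ('d _ _ _).
  by apply/pair_equal_spec; rewrite /= scaler0 addr0.
rewrite (_ : (fun _ => _) = \sum_(j < n) (fun a => ('d m1 (a, a0) (0, y)) 0 j *:
    'd m1 (a, chart_rep (@lg_inv _ _ G) 1g a) (delta_mx 0 j, 0))); last first.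
  by apply/funext => a; rewrite fct_sumE.
apply: differentiable_sum => j; apply: differentiable_scale_row.
  apply: (differentiable_comp (g := fun N : 'rV[R]_n => N 0 j)
    (f := fun a => 'd m1 (a, a0) (0, y))); last exact: differentiable_coord.
  apply: (differentiable_comp (g := fun z => 'd m1 z (0, y))
    (f := fun a => (a, a0))); last exact: dm.
  exact: differentiable_pair.
apply: (differentiable_comp (g := fun z => 'd m1 z (delta_mx 0 j, 0))
  (f := fun a => (a, chart_rep (@lg_inv _ _ G) 1g a))).
  exact: differentiable_pair.
by rewrite ia; exact: dm.
Qed.

(** For [g] near [1] both [g] and its inverse lie in the chart domain, so [Ad_rep] transfers the
    differentiability of the explicit formula to [Ad]. *)
Lemma differentiable_at_Ad (y : 'rV[R]_n) :
  differentiable_at (Y := model 'rV[R]_n) (fun g : G => Ad g y) 1g.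
Proof.
have [aG [od oi hK hc hic] h1] := gG 1g.
have H : {near a0, (fun a => 'd m1 (a, chart_rep (@lg_inv _ _ G) 1g a)
                              ('d m1 (a, a0) (0, y), 0)) =1
    (fun a => Ad (psi a) y)}.
  have H1 : \forall a \near a0, dom1 (lg_inv (psi a)).
    have hn : nbhs (lg_inv 1g) dom1.
      by apply: open_nbhs_nbhs; split; rewrite // lg_inv1.
    have [invc _] := differentiable_at_lg_inv 1g.
    exact: (chart_inv_cvg (p := 1g) gG (invc _ hn)).
  have H2 : nbhs a0 (chart_img (chart_at 1g)).
    by apply: open_nbhs_nbhs; split=> //; exists 1g.
  apply: filterS2 H1 H2 => a + [g hg ga].
  have e : psi a = g by rewrite -ga; exact: hK.
  rewrite e => hgi; rewrite (Ad_rep y hg hgi).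
  have -> : chart_rep (@lg_inv _ _ G) 1g a = phi (lg_inv g).
    by rewrite /chart_rep /= lg_inv1 e.
  by rewrite ga.
have [dA _] := near_eq_diff H (differentiable_Ad_rep y).
split; last exact: dA.
(* Continuity is first obtained in the chart and then pulled back to [G] through [phi], since [psi]
   undoes [phi] near [1]. *)
have cA : {for 1g, continuous ((fun a => Ad (psi a) y) \o phi)}.
  apply: continuous_comp; first exact: hc.
  exact: differentiable_continuous.
have E : {near 1g, (fun a => Ad (psi a) y) \o phi =1 (fun g : G => Ad g y)}.
  have : nbhs 1g dom1 by exact: open_nbhs_nbhs.
  by apply: filterS => g hg /=; rewrite hK.
have E1 := nbhs_singleton E.
have cA1 : ((fun a => Ad (psi a) y) \o phi) @ 1g --> Ad 1g y.
  by rewrite -E1; exact: cA.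
exact: cvg_trans (near_eq_cvg E) cA1.
Qed.

Lemma bracket_linearl (y : 'rV[R]_n) : linear (bracket G ^~ y).
Proof. exact: tmap_linear. Qed.

(** The inverse matches the one in [coad]; it is the source of the minus sign in the tangent vectors
    of the orbit. *)
Lemma tmap_Ad_inv_curve (E : normedModType R) (X : charted E) (c : X -> G)
    (p : X) (y : 'rV[R]_n) :
  good_charts X -> differentiable_at c p -> c p = 1g ->
  differentiable_at (Y := model 'rV[R]_n) (fun x => Ad (lg_inv (c x)) y) p /\
  forall v, tmap (Y := model 'rV[R]_n) (fun x => Ad (lg_inv (c x)) y) p v
    = - bracket G (tmap c p v) y.
Proof.
move=> gX dc cp; have [di ti] := tmap_inv_curve gX dc cp.
have dA := differentiable_at_Ad y.
rewrite -lg_inv1 -cp in dA.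
have [h1 h2] := differentiable_at_tmap_comp gX gG di dA.
split=> // v; rewrite [LHS](congr1 (@^~ v) h2) /= ti cp lg_inv1.
by rewrite {1}/tmap linearN.
Qed.

End LieGroupTheory.

(** * The coadjoint orbit *)

Section CoadjointTheory.
Context {R : realType} {n : nat}.
Variable G : @lie_group R n.
Let gG : good_charts G := @good_charts_lie_group R n G.

(** Bridge between [derive1], used for velocities in the dual, and tangent maps, used for the
    bracket. Linearity of [l] makes it its own differential; the differentiability clause is what
    converts [derive1] into ['d]. *)
Lemma derive1_coad_curve (c : R -> G) (l : 'rV[R]_n -> R^o) (y : 'rV[R]_n) :
  linear l -> smooth_curve c -> c 0 = lg_one G ->
  differentiable (fun t : R => coad (c t) l y : R) 0 /\
  derive1 (fun t : R => coad (c t) l y : R) 0 = - l (bracket G (velocity c) y).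
Proof.
move=> ll sc c0.
have dc : differentiable_at (X := model R) c (0 : R).
  by apply: smooth_differentiable_at => //; exact: good_charts_model.
have gR := @good_charts_model R R.
have [[_ h1] h2] := tmap_Ad_inv_curve (X := model R) y gR dc c0.
have [d1 d2] := differentiable_linear_row (Ad (lg_inv (c 0)) y) ll.
have dlc := differentiable_comp (g := l)
  (f := fun t : R => Ad (lg_inv (c t)) y) h1 d1.
split; first exact: dlc.
rewrite (derive1E' dlc) diff_comp //= d2.
have -> : 'd (fun t : R => Ad (lg_inv (c t)) y) (0 : R) 1
    = - bracket G (velocity c) y.
  exact: h2.
pose L : {linear 'rV[R]_n -> R^o} :=
  HB.pack l (GRing.isLinear.Build _ _ _ _ _ ll).
by rewrite -[l]/(L : _ -> _) linearN.
Qed.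

Lemma dual_velocity_coad (c : R -> G) (l : 'rV[R]_n -> R^o) :
  linear l -> smooth_curve c -> c 0 = lg_one G ->
  dual_velocity (fun t => coad (c t) l) = - adstar G (velocity c) l.
Proof.
by move=> ll sc c0; apply/funext => y; exact: (derive1_coad_curve y ll sc c0).2.
Qed.

(** Velocities are taken pointwise, and off [h] the restricted curve is constantly 0. *)
Lemma dual_velocity_restr (h : set 'rV[R]_n) (c : R -> 'rV[R]_n -> R^o) :
  dual_velocity (fun t => restr h (c t)) = restr h (dual_velocity c).
Proof.
apply/funext => y; rewrite /dual_velocity /restr /patch.
by case: ifP => // _; exact: derive1_cst.
Qed.

Lemma restr_eq0 (h : set 'rV[R]_n) (l : 'rV[R]_n -> R^o) :
  restr h l = 0 <-> forall y, h y -> l y = 0.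
Proof.
split=> [hl y hy|hl].
  by have /(congr1 (@^~ y)) := hl; rewrite /restr /patch mem_set.
apply/funext => y; rewrite /restr /patch; case: ifPn => // /set_mem.
exact: hl.
Qed.

Lemma adstar_linear (l : 'rV[R]_n -> R^o) : linear l ->
  linear (fun x => adstar G x l).
Proof.
move=> ll a u v; apply/funext => y.
by rewrite /adstar bracket_linearl ll.
Qed.

Lemma exponential0 (expG : 'rV[R]_n -> G) (x : 'rV[R]_n) :
  is_exponential expG -> expG (0 *: x) = lg_one G.
Proof. by move=> /(_ x)[hD _ _]; apply: lg_idem; rewrite -hD addr0. Qed.

(** A tangent vector depends on its curve only through the velocity of the curve at 0, which gives
    one inclusion; the one-parameter subgroups of [expG] realize every velocity, which gives the
    other. *)
Lemma ker_dPhiE (expG : 'rV[R]_n -> G) (h : set 'rV[R]_n)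
    (l : 'rV[R]_n -> R^o) :
  is_exponential expG -> linear l ->
  ker_dPhi G h l
    = dot_dual G [set x | forall y, h y -> l (bracket G x y) = 0] l.
Proof.
move=> hexp ll; apply/seteqP; split=> [_ [c [sc c0 -> hr]]|_ [x hx <-]].
  move: hr; rewrite dual_velocity_restr dual_velocity_coad // => /restr_eq0 hr.
  exists (velocity c) => // y /hr /eqP.
  by rewrite /= oppr_eq0 => /eqP.
have [_ sc hv] := hexp x.
have c0 := exponential0 x hexp.
exists (fun t => expG (t *: x)); split=> //.
  by rewrite dual_velocity_coad // hv.
rewrite dual_velocity_restr dual_velocity_coad // hv; apply/restr_eq0 => y hy.
by rewrite -[LHS]/(- l (bracket G x y)) hx // oppr0.
Qed.

End CoadjointTheory.

(** * Lie subgroups and their Lie algebras *)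

Section LieSubgroup.
Context {R : realType} {k n : nat}.
Variables (H : @lie_group R k) (G : @lie_group R n) (i : H -> G).
Hypothesis hi : is_lie_subgroup i.
Let gH : good_charts H := @good_charts_lie_group R k H.
Let gG : good_charts G := @good_charts_lie_group R n G.

Lemma lie_subgroup1 : i (lg_one H) = lg_one G.
Proof. by apply: lg_idem; rewrite -(ls_mul hi) lg_mul1. Qed.

Lemma lie_subgroup_inv (h : H) : i (lg_inv h) = lg_inv (i h).
Proof.
rewrite -[LHS]lg_mul1_r -(lg_mulV_r (i h)) lg_mulA -(ls_mul hi) lg_mulV.
by rewrite lie_subgroup1 lg_mul1.
Qed.

Lemma differentiable_at_lie_subgroup (h : H) : differentiable_at i h.
Proof. by apply: smooth_differentiable_at => //; exact: ls_smooth hi. Qed.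

(** The homomorphism [i] intertwines conjugation by [h] with conjugation by [i h]; the chain rule at
    the identity does the rest. *)
Lemma tmap_Ad (h : H) (y : 'rV[R]_k) :
  tmap i (lg_one H) (Ad h y) = Ad (i h) (tmap i (lg_one H) y).
Proof.
have di := differentiable_at_lie_subgroup.
have e1 := tmap_comp gH gH (differentiable_at_conj h (lg_one H)) (di _).
have e2 := tmap_comp gH gG (di _) (differentiable_at_conj (i h) (i (lg_one H))).
have E : i \o (fun h' => lg_mul (lg_mul h h') (lg_inv h))
    = (fun g => lg_mul (lg_mul (i h) g) (lg_inv (i h))) \o i.
  by apply/funext => h' /=; rewrite !(ls_mul hi) lie_subgroup_inv.
move: e2; rewrite -E e1 lie_subgroup1 lg_conj1 => /(congr1 (@^~ y)).
exact.
Qed.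

(** Obtained by differentiating [tmap_Ad] in [h] at the identity; it makes [lie_subalg i] closed
    under the bracket. *)
Lemma tmap_bracket (x y : 'rV[R]_k) :
  tmap i (lg_one H) (bracket H x y)
    = bracket G (tmap i (lg_one H) x) (tmap i (lg_one H) y).
Proof.
have di := differentiable_at_lie_subgroup (lg_one H).
have dA := differentiable_at_Ad G (tmap i (lg_one H) y).
rewrite -lie_subgroup1 in dA.
have e2 := tmap_comp gH gG di dA.
pose gm := @good_charts_model R.
(* The tangent map of [i] is now treated as a map between model spaces; being linear, it is its own
   differential. *)
have [dl el] := differentiable_linear_row (Ad (lg_one H) y)
  (tmap_linear i (lg_one H)).
have dl' : differentiable_at (X := model 'rV[R]_k) (Y := model 'rV[R]_n)
    (tmap i (lg_one H)) (Ad (lg_one H) y).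
  by split; [exact: differentiable_continuous|exact: dl].
have e1 := tmap_comp gH (gm _) (differentiable_at_Ad H y) dl'.
have E : tmap i (lg_one H) \o (fun h => Ad h y)
    = (fun g => Ad g (tmap i (lg_one H) y)) \o i.
  by apply/funext => h; exact: tmap_Ad.
move: e2; rewrite -E e1 lie_subgroup1 => /(congr1 (@^~ x)) e3.
apply: etrans e3; exact: (esym (congr1 (@^~ (bracket H x y)) el)).
Qed.

Lemma lie_subalg_bracket (x y : 'rV[R]_n) :
  lie_subalg i x -> lie_subalg i y -> lie_subalg i (bracket G x y).
Proof.
move=> [u _ <-] [v _ <-]; rewrite -tmap_bracket.
by exists (bracket H u v).
Qed.

(* [restr] extends by [0], so this relies on [lie_subalg i] being closed under
   the bracket. *)
Lemma sub_stab_algE (l : 'rV[R]_n -> R^o) :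
  sub_stab_alg G (lie_subalg i) l
    = [set x | lie_subalg i x /\
               forall y, lie_subalg i y -> l (bracket G x y) = 0].
Proof.
have E x y : lie_subalg i x -> lie_subalg i y ->
    adstar G x (restr (lie_subalg i) l) y = l (bracket G x y).
  move=> hx hy; rewrite /adstar /restr /patch mem_set //.
  exact: lie_subalg_bracket.
apply/seteqP; split=> x [hx] H0; split=> //.
  by move=> y hy; rewrite -E //; move: y hy; apply/restr_eq0.
by apply/restr_eq0 => y hy; rewrite E // H0.
Qed.

End LieSubgroup.

(** * The momentum map *)

Section Momentum.
Context {R : realType} {n d : nat}.
Variables (G : @lie_group R n) (expG : 'rV[R]_n -> G).
Variables (M : charted 'rV[R]_d) (om : two_form M) (act : G -> M -> M).
Variable Phi : M -> 'rV[R]_n -> R^o.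
Hypothesis hexp : is_exponential expG.
Hypothesis hM : is_manifold M.
Hypothesis hom : is_symplectic_form om.
Hypothesis hact : is_proper_action act.
Hypothesis hPhi : is_momentum_map expG act om Phi.
Let gG : good_charts G := @good_charts_lie_group R n G.
Let gM : good_charts M := good_charts_manifold hM.

Lemma differentiable_at_orbit (x : 'rV[R]_n) (p : M) :
  differentiable_at (X := model R) (fun t : R => act (expG (t *: x)) p) (0 : R).
Proof.
have gR := @good_charts_model R R.
have [_ sc _] := hexp x.
have dc : differentiable_at (X := model R) (fun t : R => expG (t *: x)) (0 : R).
  exact: smooth_differentiable_at.
have [dp _] := differentiable_at_tmap_pair dc
  (proj1 (differentiable_at_tmap_cst (X := model R) p (0 : R))).
have gGM := good_charts_prod gG gM.
exact: (differentiable_at_comp gR gGM dp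
  (smooth_differentiable_at _ gGM gM (act_smooth hact))).
Qed.

(** The function [Phi _ y] is differentiated along the orbit curve of [x] in two ways. The chain
    rule and the momentum equation give [om] of the two fields in reversed order; equivariance turns
    the curve into a coadjoint one, with derivative minus the bracket term. *)
Lemma symplectic_fund (x y : 'rV[R]_n) (p : M) :
  om p (fund expG act x p) (fund expG act y p) = Phi p (bracket G x y).
Proof.
rewrite (om_antisym hom) (mom_eq hPhi).
have gR := @good_charts_model R R.
have [_ sc hv] := hexp x.
have dP : differentiable_at (Y := model R) (fun q => Phi q y) p.
  by apply: smooth_differentiable_at => //; exact: mom_smooth hPhi y.
(* The chain rule is based at the left-hand side, and preferred charts depend on the base point, so
   hypotheses are moved along this equality. *)
have p0 : act (expG (0 *: x)) p = p by rewrite exponential0 // (act_one hact).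
have dP' := dP; rewrite -p0 in dP'.
have e := tmap_comp gR gM (differentiable_at_orbit x p) dP'.
have E : (fun q => Phi q y) \o (fun t : R => act (expG (t *: x)) p)
    = (fun t : R => coad (expG (t *: x)) (Phi p) y).
  by apply/funext => t /=; rewrite (mom_equivariant hPhi).
have [dc Dc] := derive1_coad_curve y (mom_linear hPhi p) sc
  (exponential0 x hexp).
rewrite hv (derive1E' dc) in Dc.
rewrite p0 E in e; apply: oppr_inj; rewrite opprK -Dc.
by rewrite -tmap_model e.
Qed.

Lemma symplectic_form_inj (p : M) (u w : 'rV[R]_d) :
  (forall v, om p u v = om p w v) -> u = w.
Proof.
move=> uw; apply/subr0_eq; apply: (om_nondegenerate hom (p := p)) => v.
by rewrite addrC -scaleN1r (om_linear hom) uw mulN1r addNr.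
Qed.

(** Linearity is not visible in [fund], since [is_exponential] describes [expG] only along lines
    through 0. The momentum equation makes the pairing with [om] linear in [x], and nondegeneracy
    lifts this to the vectors. *)
Lemma fund_linear (p : M) : linear (fun x => fund expG act x p).
Proof.
move=> a x y; apply: (@symplectic_form_inj p) => v.
pose r z : 'rV[R]_d -> R := chart_rep (Y := model R) (fun q => Phi q z) p.
have dP z : differentiable (r z) (chart_map (chart_at p) p).
  have [] // : differentiable_at (Y := model R) (fun q => Phi q z) p.
  apply: smooth_differentiable_at => //; last exact: mom_smooth hPhi z.
  exact: good_charts_model.
have re z : om p (fund expG act z p) v = 'd (r z) (chart_map (chart_at p) p) v.
  exact: mom_eq hPhi z p v.
have rD : r (a *: x + y) = a *: r x + r y.
  by apply/funext => z; exact: mom_linear hPhi _ a x y.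
apply: (etrans (re (a *: x + y))).
apply: (etrans (diff_scaleD v rD (dP x) (dP y))).
apply: (etrans _ (esym (om_linear hom p v a _ _))).
exact: (esym (f_equal2 (fun b c : R => a * b + c) (re x) (re y))).
Qed.

End Momentum.

(** * The slice and the isomorphism *)

Theorem proposition4p1 (R : realType) (n k d : nat)
  (G : @lie_group R n) (expG : 'rV[R]_n -> G) (hexp : is_exponential expG)
  (H : @lie_group R k) (i : H -> G) (hi : is_lie_subgroup i)
  (M : charted 'rV[R]_d) (hM : is_manifold M)
  (om : two_form M) (hom : is_symplectic_form om)
  (act : G -> M -> M) (hact : is_proper_action act)
  (hpres : preserves_form act om)
  (Phi : M -> 'rV[R]_n -> R^o) (hPhi : is_momentum_map expG act om Phi)
  (m : M)
  (hA : forall g : G, stabilizer act m g ->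
     [set lg_mul (lg_mul g h) (lg_inv g) | h in range i] = range i)
  (s : set 'rV[R]_n)
  (hs : complement_in s
     (sumset (stab_alg G (Phi m)) (sub_stab_alg G (lie_subalg i) (Phi m)))
     (perp expG act om (lie_subalg i) m))
  (hs_inv : forall g : G, stabilizer act m g -> forall x, s x -> s (Ad g x)) :
  is_symplectic_slice G (dot_dual G s (Phi m)) (lie_subalg i) (Phi m) /\
  exists f : 'rV[R]_d -> ('rV[R]_n -> R^o),
    linear_iso_on (dot_pt expG act s m) (dot_dual G s (Phi m)) f /\
    (forall x, s x -> f (fund expG act x m) = - adstar G x (Phi m)).
Proof.
set h := lie_subalg i in hs *; set mu := Phi m in hs *.
have lmu : linear mu := mom_linear hPhi m.
have lad := adstar_linear G lmu.
have lfd := fund_linear hM hom hPhi m.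
have omE := symplectic_fund hexp hM hom hact hPhi.
pose A x : 'rV[R]_n -> R^o := - adstar G x mu.
have lA : linear A by move=> a u v; rewrite /A lad opprD scalerN.
pose L : {linear 'rV[R]_n -> ('rV[R]_n -> R^o)} :=
  HB.pack A (GRing.isLinear.Build _ _ _ _ _ lA).
have A0 : A 0 = 0 := linear0 L.
have AB u v : A (u - v) = A u - A v := linearB L u v.
have AD u v : A (u + v) = A u + A v := linearD L u v.
have AP x : A x = 0 <-> stab_alg G mu x.
  by split=> [/eqP|/= xl]; rewrite /A ?xl ?oppr0 // oppr_eq0 => /eqP.
have perpE : perp expG act om h m =
    [set x | forall y, h y -> mu (bracket G x y) = 0].
  apply/seteqP; split=> [x hx y hy|x hx _ [y hy <-]].
    by apply: etrans (esym (omE x y m)) _; apply: hx; exists y.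
  exact: etrans (omE x y m) (hx y hy).
have kerE : ker_dPhi G h mu = dot_dual G (perp expG act om h m) mu.
  by rewrite (ker_dPhiE h hexp lmu) perpE.
have [[s0 ss] sI sS] := hs.
have sB u v : s u -> s v -> s (u - v).
  by move=> su sv; have := ss (-1) v u sv su; rewrite scaleN1r addrC.
have k0 : sub_stab_alg G h mu 0.
  rewrite sub_stab_algE //; split.
    by exists 0 => //; rewrite /tmap linear0.
  by move=> y _; move: A0 => /(congr1 (@^~ y))/eqP; rewrite /= oppr_eq0 => /eqP.
(* Here [x] is the sum of [x - y], in the kernel of [A], and of [y], so it lies in both [s] and its
   complement. A general [y] yields directness of the sum in the dual; [y = 0] yields injectivity of
   [A] on [s]. *)
have sK x y : s x -> sub_stab_alg G h mu y -> A x = A y -> x = 0.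
  move=> sx hy e; have : (s `&` sumset (stab_alg G mu) (sub_stab_alg G h mu)) x.
    split=> //; exists (x - y); first by apply/AP; rewrite AB e subrr.
    by exists y => //; rewrite subrK.
  by rewrite sI.
have dotsub : is_subspace (dot_dual G s mu).
  split; first by exists 0.
  move=> a _ _ [u su <-] [v sv <-].
  by exists (a *: u + v); [exact: ss|exact: lA].
split.
  split=> //.
  - apply/seteqP; split=> [_ [[x sx <-] [y hy e]]|_ ->].
      by rewrite /= (sK x y sx hy (esym e)) -/(A 0) A0.
    by split; exists 0.
  (* The [stab_alg] component is chosen to be 0 in one direction and is killed by [A] in the
     other. *)
  - rewrite kerE -sS; apply/seteqP.
    split=> [_ [_ [x sx <-] [_ [y hy <-] <-]]|
             _ [_ [x sx [_ [z sz [y hy <-]] <-]] <-]].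
      exists (x + y); last exact: AD.
      exists x => //; exists y => //; exists 0; first by apply/AP.
      by exists y => //; rewrite add0r.
    exists (A x); first by exists x.
    exists (A y); first by exists y.
    by rewrite -/(A _) !AD (AP z).2 // add0r.
(* Since [f] takes tangent vectors rather than elements of [s], its value does not depend on the [x]
   representing a vector. *)
pose f v : 'rV[R]_n -> R^o := fun y => - om m v (fund expG act y m).
have fE x : f (fund expG act x m) = A x.
  by apply/funext => y; rewrite /f omE.
exists f; split=> //; split=> //.
- split.
    (* The scalar [-1] at two zero vectors makes linearity say that the fundamental field of 0
       vanishes at [m]. *)
    by exists 0 => //; have := lfd (-1) 0 0; rewrite !scaleN1r !addNr.
  move=> a _ _ [u su <-] [v sv <-].
  by exists (a *: u + v); [exact: ss|exact: lfd].
- move=> a u v _ _; apply/funext => y.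
  by rewrite /f (om_linear hom) opprD -mulrN.
- split.
  + by move=> _ [x sx <-]; exists x.
  + move=> _ _ /set_mem[x sx <-] /set_mem[y sy <-] e.
    (* Equal images under [f] already force [x = y] in [s], hence equal tangent vectors. *)
    have Axy : A (x - y) = 0.
      apply: (etrans (AB x y)); apply/eqP; rewrite subr_eq0; apply/eqP.
      exact: etrans (esym (fE x)) (etrans e (fE y)).
    have xy := sK (x - y) 0 (sB x y sx sy) k0 (etrans Axy (esym A0)).
    by rewrite (subr0_eq xy).
  + by move=> _ [x sx <-]; exists (fund expG act x m); [exists x|exact: fE].
Qed.
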